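(* Let $G$ be a countable amenable group for which the Left Strong Ergodic Theorem fails. Then $G$ admits a quotient group which is ICC and for which the Left Strong Ergodic Theorem fails.
   Context: A non-trivial countable group is ICC if every non-trivial element has an infinite conjugacy class. A sequence $(F_n)$ of (nonempty) finite subsets of a group $G$ is a left Følner sequence if $\lim_n|F_n\triangle tF_n|/|F_n|=0$ for all $t\in G$. The Left Strong Ergodic Theorem holds for a countable amenable group $G$ if for every unitary representation $(\mathcal{H},\pi)$ of $G$, every left Følner sequence $(F_n)$ in $G$ and every $v\in\mathcal{H}$, $\lim_n\frac{1}{|F_n|}\sum_{s\in F_n}\pi(s)v=P_Gv$ in norm, where $P_G$ is the orthogonal projection onto the closed subspace of $\pi(G)$-invariant vectors; otherwise it fails for $G$. *)

(* Defs.v *)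
From HB Require Import structures.
From mathcomp Require Import all_boot all_order all_algebra.
From mathcomp Require Import finmap complex.
From mathcomp Require Import all_classical all_reals all_analysis.

Set Implicit Arguments.
Unset Strict Implicit.
Unset Printing Implicit Defensive.

Import Order.TTheory GRing.Theory Num.Theory.
Import numFieldNormedType.Exports.

Local Open Scope classical_set_scope.
Local Open Scope ring_scope.
Local Open Scope complex_scope.
Local Open Scope quotient_scope.

Record normalSubgroup (G : groupType) := NormalSubgroup {
  normal_set :> set G;
  normal1 : normal_set 1%g;
  normalF : forall x y, normal_set x -> normal_set y -> normal_set (x / y)%g;
  normalJ : forall x y, normal_set x -> normal_set (x ^ y)%g
}.

Section Quotient.
Variables (G : groupType) (N : normalSubgroup G).
Implicit Types x y z : G.

Let normalV x : normal_set N x -> normal_set N x^-1%g.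
Proof. by move=> Nx; rewrite -div1g; apply: normalF Nx; apply: normal1. Qed.

Let normalM x y : normal_set N x -> normal_set N y -> normal_set N (x * y)%g.
Proof. by move=> Nx /normalV Ny; rewrite -[y]invgK; apply: normalF. Qed.

Definition coset_rel : rel G := fun x y => `[< normal_set N (x^-1 * y)%g >].

Lemma coset_rel_refl : reflexive coset_rel.
Proof. by move=> x; apply/asboolP; rewrite mulVg; apply: normal1. Qed.

Lemma coset_rel_sym : symmetric coset_rel.
Proof.
move=> x y; apply/asboolP/asboolP => /normalV; by rewrite invgM invgK.
Qed.

Lemma coset_rel_trans : transitive coset_rel.
Proof.
move=> y x z /asboolP Nxy /asboolP Nyz; apply/asboolP.
by have := normalM Nxy Nyz; rewrite mulgA mulgK.
Qed.

Canonical coset_equiv :=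
  EquivRel coset_rel coset_rel_refl coset_rel_sym coset_rel_trans.

Definition quotient_group := {eq_quot coset_equiv}.
HB.instance Definition _ := Choice.on quotient_group.
HB.instance Definition _ := EqQuotient.on quotient_group.

Definition quotient_proj x : quotient_group := \pi_quotient_group x.

Lemma quotient_projP x y :
  reflect (normal_set N (x^-1 * y)%g) (quotient_proj x == quotient_proj y).
Proof. by rewrite /quotient_proj eqmodE; apply: asboolP. Qed.

Definition quotient_mul (a b : quotient_group) : quotient_group :=
  quotient_proj (repr a * repr b)%g.
Definition quotient_inv (a : quotient_group) : quotient_group :=
  quotient_proj (repr a)^-1%g.

Let reprP x : normal_set N (x^-1 * repr (quotient_proj x))%g.
Proof. by apply/quotient_projP; rewrite /quotient_proj reprK. Qed.

Let projK a : quotient_proj (repr a) = a.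
Proof. by rewrite /quotient_proj reprK. Qed.

Let mulE x y :
  quotient_mul (quotient_proj x) (quotient_proj y) = quotient_proj (x * y)%g.
Proof.
apply/esym/eqP/quotient_projP; rewrite invgM.
have := normalM (normalJ y (reprP x)) (reprP y).
by rewrite conjgE !mulgA mulgK.
Qed.

Let invE x : quotient_inv (quotient_proj x) = quotient_proj x^-1%g.
Proof.
apply/esym/eqP/quotient_projP; rewrite invgK.
have := normalV (normalJ x^-1%g (reprP x)).
by rewrite conjgE invgK -mulgA mulVKg invgM invgK.
Qed.

Let quotient_mulA : associative quotient_mul.
Proof.
by move=> a b c; rewrite -[a]projK -[b]projK -[c]projK !mulE mulgA.
Qed.

Let quotient_mul1 : left_id (quotient_proj 1%g) quotient_mul.
Proof. by move=> a; rewrite -[a]projK mulE mul1g. Qed.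

Let quotient_1mul : right_id (quotient_proj 1%g) quotient_mul.
Proof. by move=> a; rewrite -[a]projK mulE mulg1. Qed.

Let quotient_mulV : left_inverse (quotient_proj 1%g) quotient_inv quotient_mul.
Proof. by move=> a; rewrite -[a]projK invE mulE mulVg. Qed.

Let quotient_Vmul : right_inverse (quotient_proj 1%g) quotient_inv quotient_mul.
Proof. by move=> a; rewrite -[a]projK invE mulE mulgV. Qed.

HB.instance Definition _ := isGroup.Build quotient_group
  quotient_mulA quotient_mul1 quotient_1mul quotient_mulV quotient_Vmul.

Lemma quotient_projM : {morph quotient_proj : x y / (x * y)%g}.
Proof. by move=> x y; rewrite [RHS]mulE. Qed.

Lemma quotient_proj_surj : set_surj [set: G] [set: quotient_group] quotient_proj.
Proof. by move=> a _; exists (repr a); rewrite ?projK. Qed.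

End Quotient.

Definition conjugacy_class (G : groupType) (x : G) : set G :=
  [set (x ^ y)%g | y in [set: G]].

Definition icc (G : groupType) : Prop :=
  [/\ countable [set: G],
      exists x : G, x <> 1%g &
      forall x : G, x <> 1%g -> infinite_set (conjugacy_class x)].

(* von Neumann's definition, for the discrete group G: mu is a left-invariant
   finitely additive probability measure on all subsets of G. *)
Definition amenable (R : realType) (G : groupType) : Prop :=
  exists mu : set G -> R,
    [/\ forall A, 0 <= mu A,
        mu [set: G] = 1,
        forall A B, A `&` B = set0 -> mu (A `|` B) = mu A + mu B &
        forall (t : G) A, mu [set (t * x)%g | x in A] = mu A].

Lemma quotient_countable (G : groupType) (N : normalSubgroup G) :
  countable [set: G] -> countable [set: quotient_group N].
Proof.
move=> cG; apply: (@sub_countable _ _ _ (quotient_proj N @` [set: G])).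
  apply: subset_card_le => a _; have [x _ <-] := @quotient_proj_surj _ N a I.
  by exists x.
exact: card_le_trans (card_image_le _ _) cG.
Qed.

Lemma quotient_amenable (R : realType) (G : groupType)
    (N : normalSubgroup G) :
  amenable R G -> amenable R (quotient_group N).
Proof.
move=> [mu [mu0 mu1 muU muT]]; exists (fun A => mu (quotient_proj N @^-1` A)).
split=> [A||A B AB|a A] //.
  by rewrite preimage_setU muU // -preimage_setI AB preimage_set0.
have [t _ <-] := @quotient_proj_surj _ N a I.
rewrite -(muT t (quotient_proj N @^-1` A)); congr mu; apply/seteqP; split=> x /=.
  move=> [b Ab bx]; exists (t^-1 * x)%g; last by rewrite mulVKg.
  suff -> : quotient_proj N (t^-1 * x)%g = b by [].
  by apply: (@mulgI _ (quotient_proj N t)); rewrite -quotient_projM mulVKg.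
by move=> [y Ay <-]; exists (quotient_proj N y); rewrite ?quotient_projM.
Qed.

Definition left_translate (G : groupType) (t : G) (A : {fset G}) : {fset G} :=
  [fset (t * x)%g | x in A]%fset.

Definition fsymdiff (K : choiceType) (A B : {fset K}) : {fset K} :=
  ((A `\` B) `|` (B `\` A))%fset.

Definition left_folner (R : realType) (G : groupType) (F : nat -> {fset G}) :
    Prop :=
  (forall n, F n != fset0) /\
  forall t : G,
    ((#|` fsymdiff (F n) (left_translate t (F n)) |%:R / #|` F n |%:R : R)
       @[n --> \oo] --> (0 : R)).

(* The inner product is linear in its first argument. *)
Record hilbertSpace (R : realType) := HilbertSpace {
  hilbert_sort :> completeNormedModType R[i];
  inner : {dot hilbert_sort for (@Num.conj R[i])};
  inner_norm : forall v : hilbert_sort, `|v| ^+ 2 = inner v v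
}.

Definition unitary (R : realType) (H : hilbertSpace R)
    (U : {linear H -> H}) : Prop :=
  (forall v w : H, inner H (U v) (U w) = inner H v w) /\
  set_surj [set: H] [set: H] U.

Record unitaryRep (R : realType) (G : groupType) (H : hilbertSpace R) :=
  UnitaryRep {
    rep_op :> G -> {linear H -> H};
    rep_unitary : forall s, unitary (rep_op s);
    rep1 : forall v, rep_op 1%g v = v;
    repM : forall s t v, rep_op (s * t)%g v = rep_op s (rep_op t v)
  }.

Definition invariant_vectors (R : realType) (G : groupType)
    (H : hilbertSpace R) (pi : unitaryRep G H) : set H :=
  [set v | forall s, pi s v = v].

(* The orthogonal projection of v onto a closed subspace V: the unique p in V
   such that v - p is orthogonal to V. *)
Definition orth_proj (R : realType) (H : hilbertSpace R) (V : set H) (v : H) :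
    H :=
  xget 0 [set p | V p /\ forall w, V w -> inner H (v - p) w = 0].

Definition folner_average (R : realType) (G : groupType) (H : hilbertSpace R)
    (pi : unitaryRep G H) (F : {fset G}) (v : H) : H :=
  (#|` F |%:R)^-1 *: \sum_(s <- F) pi s v.

(* Meant for countable amenable G; these two properties pass to quotients by
   quotient_countable and quotient_amenable. *)
Definition left_strong_ergodic_theorem (R : realType) (G : groupType) : Prop :=
  forall (H : hilbertSpace R) (pi : unitaryRep G H) (F : nat -> {fset G}),
    left_folner R F ->
    forall v : H,
      folner_average pi (F n) v @[n --> \oo]
        --> orth_proj (invariant_vectors pi) v.

(* Main.v *)
(** Fix a unitary representation for which the theorem fails.  The vectors
    whose averages tend to 0 along every left Folner sequence form a closed
    invariant subspace E; let U be its orthogonal complement and M the kernel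
    of the action of G on U.

    G/M is ICC.  It is not trivial, since otherwise averages would be constant
    on U.  Let C be a finite conjugacy class in G/M.  On U the operator
    z = sum_(c in C) c commutes with G, so the averages of z u - |C| u are
    sum_(c in C) (c - 1) applied to those of u, and tend to 0 by the Folner
    property.  Hence z u - |C| u lies in both E and U, so z u = |C| u, and
    strict convexity gives c u = u for every c in C, that is c = 1.

    The theorem fails for G/M: otherwise it holds uniformly over sufficiently
    invariant finite sets.  The image in G/M of the counting measure of a
    Folner set F is the sum of the counting measures of its level sets, whose
    boundaries add up to at most the boundary of F; so the averages over F of
    a vector of U converge, and therefore so do those of any vector. *)

From HB Require Import structures.
Require Import Defs.
From mathcomp Require Import all_boot all_order all_algebra.
From mathcomp Require Import finmap complex ring lra.
From mathcomp Require Import all_classical all_reals all_analysis.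

Set Implicit Arguments.
Unset Strict Implicit.
Unset Printing Implicit Defensive.

Import Order.TTheory GRing.Theory Num.Theory.
Import numFieldNormedType.Exports.

Local Open Scope classical_set_scope.
Local Open Scope ring_scope.

(** * Real-valued norm and inner product of a complex Hilbert space *)

Section HilbertSpace.
Variables (R : realType) (H : hilbertSpace R).
Implicit Types (v w : H) (c : R[i]).

(** The norm of [H] takes values in [R[i]]; this is the same number in [R], where order and limits
    are the real ones. *)
Definition hnorm v : R := complex.Re `|v|.

Lemma hnormE v : `|v| = (hnorm v)%:C%C.
Proof. by rewrite /hnorm RRe_real. Qed.

Lemma hnorm_ge0 v : 0 <= hnorm v.
Proof. by rewrite -ler0c -hnormE. Qed.

Lemma hnorm0 : hnorm 0 = 0.
Proof. by rewrite /hnorm normr0. Qed.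

Lemma hnorm0_eq0 v : hnorm v = 0 -> v = 0.
Proof. by move=> v0; apply/eqP; rewrite -normr_eq0 hnormE v0. Qed.

Lemma ler_hnormD v w : hnorm (v + w) <= hnorm v + hnorm w.
Proof. by rewrite -lecR rmorphD /= -!hnormE ler_normD. Qed.

Lemma hnorm_opp v : hnorm (- v) = hnorm v.
Proof. by rewrite /hnorm normrN. Qed.

Lemma hnorm_distC v w : hnorm (v - w) = hnorm (w - v).
Proof. by rewrite -hnorm_opp opprB. Qed.

Lemma ler_hdistD u v w : hnorm (v - w) <= hnorm (v - u) + hnorm (u - w).
Proof. by rewrite (le_trans _ (ler_hnormD _ _)) // addrA subrK. Qed.

Lemma ler_hnorm_sum I (r : seq I) (P : pred I) (f : I -> H) :
  hnorm (\sum_(i <- r | P i) f i) <= \sum_(i <- r | P i) hnorm (f i).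
Proof.
elim/big_rec2: _ => [|i x v _ le_v]; first by rewrite hnorm0.
by rewrite (le_trans (ler_hnormD _ _)) // lerD2l.
Qed.

Lemma hnorm_natZ n v : hnorm (n%:R *: v) = n%:R * hnorm v.
Proof.
apply: complexI; rewrite -hnormE normrZ normr_nat rmorphM /= rmorph_nat.
by rewrite -hnormE.
Qed.

Lemma hnorm_natVZ n v : hnorm (n%:R^-1 *: v) = n%:R^-1 * hnorm v.
Proof.
apply: complexI; rewrite -hnormE normrZ normfV normr_nat rmorphM /=.
by rewrite fmorphV rmorph_nat -hnormE.
Qed.

Lemma hnorm_sqr v : (hnorm v ^+ 2)%:C%C = inner H v v.
Proof. by rewrite rmorphXn /= -hnormE inner_norm. Qed.

Lemma innerPl c u v w :
  inner H (c *: u + v) w = c * inner H u w + inner H v w.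
Proof. exact: linearPl. Qed.

Lemma innerBl u v w : inner H (u - v) w = inner H u w - inner H v w.
Proof. exact: linearBl. Qed.

Lemma inner_eq0 v : inner H v v = 0 -> v = 0.
Proof.
by move=> vv; apply/eqP; rewrite -normr_eq0 -sqrf_eq0 inner_norm vv.
Qed.

Lemma inner_eq0C v w : inner H v w = 0 -> inner H w v = 0.
Proof. by move=> /eqP vw; apply/eqP; rewrite herm_eq0C. Qed.

Lemma parallelogram v w :
  hnorm (v - w) ^+ 2 = 2 * (hnorm v ^+ 2 + hnorm w ^+ 2) - hnorm (v + w) ^+ 2.
Proof.
apply/eqP; rewrite eq_sym subr_eq eq_sym; apply/eqP/complexI.
rewrite mulr_natl mulr2n !rmorphD /= !hnorm_sqr.
rewrite (dnormB (inner H)) (dnormD (inner H)) /=.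
by rewrite addrC addrACA subrr addr0.
Qed.

Lemma cvg_hnormP (f : nat -> H) v :
  f n @[n --> \oo] --> v <->
  forall e : R, 0 < e -> \forall n \near \oo, hnorm (v - f n) < e.
Proof.
split=> [/cvgrPdist_lt fv e e0|fv].
  by have := fv e%:C%C; rewrite ltcR => /(_ e0); apply: filterS => n;
    rewrite hnormE ltcR.
apply/cvgrPdist_lt => e e0; have eE : e = (complex.Re e)%:C%C.
  by rewrite RRe_real // gtr0_real.
have {}/fv : 0 < complex.Re e by rewrite -ltcR -eE.
by apply: filterS => n; rewrite -ltcR -hnormE -eE.
Qed.

End HilbertSpace.

(** * Cauchy-Schwarz inequality and projection onto a closed subspace *)

Section HilbertProjection.
Variables (R : realType) (H : hilbertSpace R).
Implicit Types (v w : H) (V : set H).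

Lemma cvg_hnorm (f : nat -> H) v :
  f n @[n --> \oo] --> v -> hnorm (f n) @[n --> \oo] --> hnorm v.
Proof.
move=> /cvg_hnormP fv; apply/cvgrPdist_lt => e /fv; apply: filterS => n.
apply: le_lt_trans; rewrite ler_norml; apply/andP; split.
  have := ler_hnormD (f n - v) v; rewrite subrK (hnorm_distC (f n)).
  lra.
by have := ler_hnormD (v - f n) (f n); rewrite subrK; lra.
Qed.

(** Pythagoras for the removal of the component of [v] along [w]. It yields both Cauchy-Schwarz and
    the orthogonality of minimal vectors. *)
Lemma hnorm_sub_component v w : w != 0 ->
  hnorm (v - ((hnorm w ^- 2)%:C%C * inner H v w) *: w) ^+ 2 =
  hnorm v ^+ 2 - (complex.Re `|inner H v w|) ^+ 2 / hnorm w ^+ 2.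
Proof.
move=> w0; set c := inner H v w; set W := hnorm w ^+ 2.
have W0 : W != 0.
  by rewrite expf_eq0 /=; apply: contraNneq w0 => /hnorm0_eq0 ->.
have cE : `|c| = (complex.Re `|c|)%:C%C by rewrite RRe_real.
set r := complex.Re `|c| in cE *; pose t := W^-1.
have t0 : 0 <= t by rewrite invr_ge0 exprn_ge0 ?hnorm_ge0.
have dE : inner H v ((t%:C%C * c) *: w) = (t * r ^+ 2)%:C%C.
  rewrite linearZr_LR /= -/c [X in X * _ = _]rmorphM /= -mulrA.
  rewrite [c^* * c]mulrC -normCK cE conj_Creal ?complex_real //.
  by rewrite rmorphM rmorphXn.
have wE : hnorm ((t%:C%C * c) *: w) ^+ 2 = t * r ^+ 2.
  have t0C : 0 <= t%:C%C by rewrite ler0c.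
  have -> : hnorm ((t%:C%C * c) *: w) = t * r * hnorm w.
    apply: complexI; rewrite -hnormE normrZ normrM cE ger0_norm //.
    by rewrite hnormE !rmorphM.
  rewrite !exprMn -/W; transitivity (t * r ^+ 2 * (W * t)); first by ring.
  by rewrite mulfV ?mulr1.
transitivity (hnorm v ^+ 2 + t * r ^+ 2 - (t * r ^+ 2 + t * r ^+ 2)).
  apply: complexI; rewrite -{1}wE hnorm_sqr (dnormB (inner H)) dE.
  by rewrite conj_Creal ?complex_real // -!hnorm_sqr !(rmorphB, rmorphD).
by rewrite opprD addrACA subrr addr0 [t * _]mulrC.
Qed.

Lemma inner_CauchySchwarz v w :
  complex.Re `|inner H v w| <= hnorm v * hnorm w.
Proof.
have r0 : 0 <= complex.Re `|inner H v w| by rewrite -ler0c RRe_real.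
have [->|w0] := eqVneq w 0.
  by rewrite linear0r normr0 hnorm0 mulr0.
rewrite -ler_sqr ?nnegrE ?mulr_ge0 ?hnorm_ge0 // exprMn.
have W0 : 0 < hnorm w ^+ 2.
  rewrite exprn_gt0 // lt_neqAle hnorm_ge0 andbT eq_sym.
  by apply: contraNneq w0 => /hnorm0_eq0 ->.
by rewrite -ler_pdivrMr // -subr_ge0 -hnorm_sub_component // sqr_ge0.
Qed.

(** Removing the component along [w] would lower the norm unless that component vanishes. *)
Lemma orthogonal_of_minimal v w :
  (forall c : R[i], hnorm v ^+ 2 <= hnorm (v - c *: w) ^+ 2) ->
  inner H v w = 0.
Proof.
move=> vmin; have [->|w0] := eqVneq w 0; first by rewrite linear0r.
have := vmin ((hnorm w ^- 2)%:C%C * inner H v w).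
rewrite hnorm_sub_component // lerDl oppr_ge0 ler_pdivrMr ?mul0r => [r0|].
  have rE : complex.Re `|inner H v w| = 0.
    by apply/eqP; rewrite -sqrf_eq0 eq_le r0 sqr_ge0.
  by apply/eqP; rewrite -normr_eq0 -(RRe_real (normr_real _)) rE.
rewrite exprn_gt0 // lt_neqAle hnorm_ge0 andbT eq_sym.
by apply: contraNneq w0 => /hnorm0_eq0 ->.
Qed.

(** A sequence in [V] minimising the distance to [v] is Cauchy by the parallelogram law, and its
    limit realises the distance. *)
Lemma orth_decomposition V v :
  V 0 -> (forall c u w, V u -> V w -> V (c *: u + w)) -> closed V ->
  exists p, V p /\ forall w, V w -> inner H (v - p) w = 0.
Proof.
move=> V0 VP Vc; pose D := [set hnorm (v - w) ^+ 2 | w in V].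
have D_inf : has_inf D.
  split; first by exists (hnorm (v - 0) ^+ 2); exists 0.
  by exists 0 => _ [w _ <-]; rewrite exprn_ge0 ?hnorm_ge0.
pose d := inf D.
have dP w : V w -> d <= hnorm (v - w) ^+ 2.
  by move=> Vw; apply: ge_inf; [case: D_inf|exists w].
have VZ c w : V w -> V (c *: w) by move=> Vw; rewrite -[_ *: w]addr0; apply: VP.
have VD u w : V u -> V w -> V (u + w).
  by move=> Vu Vw; rewrite -[u]scale1r; apply: VP.
have near_d (n : nat) : exists w, V w /\ hnorm (v - w) ^+ 2 < d + n.+1%:R^-1.
  have [|_ [w Vw <-] lt_d] := @inf_adherent _ D n.+1%:R^-1 _ D_inf.
    by rewrite invr_gt0.
  by exists w.
have [f fP] := choice near_d.
have fC m n : hnorm (f m - f n) ^+ 2 <= 2 * (m.+1%:R^-1 + n.+1%:R^-1).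
  have -> : f m - f n = v - f n - (v - f m) 
    by rewrite opprB [RHS]addrC addrA subrK.
  rewrite parallelogram.
  (* The midpoint of [f n] and [f m] lies in [V], so this sum has norm at least twice the distance
     from [v] to [V]. *)
  have -> : v - f n + (v - f m) = 2%:R *: (v - 2%:R^-1 *: (f n + f m)).
    rewrite scalerBr scalerA divff ?pnatr_eq0 // scale1r scaler_nat mulr2n.
    by rewrite addrACA opprD.
  rewrite hnorm_natZ exprMn.
  have := dP (2^-1 *: (f n + f m)) (VZ _ _ (VD _ _ (fP n).1 (fP m).1)).
  have [_] := fP n; have [_] := fP m.
  move: (d) (_ ^+ 2) (_ ^+ 2) (_ ^+ 2) (m.+1%:R^-1) (n.+1%:R^-1).
  by clear=> *; lra.
have f_cvg : cvg (f n @[n --> \oo]).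
  apply/cauchy_cvgP/cauchy_exP => e e0.
  have eE : e = (complex.Re e)%:C%C by rewrite RRe_real // gtr0_real.
  set r := complex.Re e in eE; have r0 : 0 < r by rewrite -ltcR -eE.
  (* A quarter suffices since the bound [fC] is twice a sum of two such terms. *)
  have r4 : 0 < r ^+ 2 / 4 by rewrite divr_gt0 ?exprn_gt0.
  have [N _ NP] := near_infty_natSinv_lt (PosNum r4).
  exists (f N); exists N => // n /= /NP /= ltn.
  have ltN := NP N (leqnn N); rewrite /= in ltN.
  rewrite -ball_normE /= hnormE eE ltcR -ltr_sqr ?nnegrE ?hnorm_ge0 ?ltW //.
  have := fC N n; move: (_ ^+ 2) (_ ^+ 2) (N.+1%:R^-1) (n.+1%:R^-1) ltn ltN.
  by clear=> *; lra.
exists (lim (f n @[n --> \oo])); set p := lim _; have Vp : V p.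
  by apply: closed_cvg Vc _ _ f_cvg; apply: nearW => n; case: (fP n).
have pd : hnorm (v - p) ^+ 2 <= d.
  have cv : hnorm (v - f n) ^+ 2 @[n --> \oo] --> hnorm (v - p) ^+ 2.
    have vf : hnorm (v - f n) @[n --> \oo] --> hnorm (v - p).
      by apply: cvg_hnorm; apply: cvgB => //; apply: cvg_cst.
    exact: (cvgM vf vf).
  have cd : d + n.+1%:R^-1 @[n --> \oo] --> d.
    rewrite -[X in _ --> X]addr0.
    by apply: cvgD; [apply: cvg_cst|apply: cvg_harmonic].
  by apply: (ler_cvg_to cv cd); apply: nearW => n; apply: ltW; case: (fP n).
split=> // w Vw; apply: orthogonal_of_minimal => c.
apply: (le_trans pd); rewrite -addrA -opprD; apply: dP.
by apply: VD => //; apply: VZ.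
Qed.
End HilbertProjection.

(** * Level sets of the image of a counting measure *)

Section Layers.
Variables (K L : choiceType) (phi : K -> L).
Implicit Types (A B : {fset K}) (a : L) (j : nat).

Definition fiber_size A a : nat := count (fun x => phi x == a) A.

(** The image under [phi] of the counting measure of [A] has density [fiber_size A]; the layers are
    its level sets. *)
Definition layer A j : {fset L} :=
  [fset a in (phi @` A)%fset | (j < fiber_size A a)%N]%fset.

Lemma fiber_size_gt0 A a : (0 < fiber_size A a)%N -> a \in (phi @` A)%fset.
Proof.
rewrite -has_count => /hasP[x xA /eqP <-]; exact: in_imfset.
Qed.

Lemma in_layer A j a : (a \in layer A j) = (j < fiber_size A a)%N.
Proof.
rewrite !inE; case: ltnP => [lt_j|]; rewrite ?andbF // andbT.
exact/fiber_size_gt0/(leq_ltn_trans _ lt_j).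
Qed.

Lemma sum_fibers (V : nmodType) A (f : L -> V) :
  \sum_(x <- A) f (phi x) =
  \sum_(a <- (phi @` A)%fset) f a *+ fiber_size A a.
Proof.
rewrite (partition_big_imfset _ phi) /=; apply: eq_bigr => a _.
transitivity (\sum_(x <- A | phi x == a) f a).
  by apply: eq_bigr => x /eqP ->.
by rewrite big_const_seq iter_addr_0.
Qed.

(** Layer-cake formula: [a] lies in exactly the layers with index below [fiber_size A a], and no
    fiber exceeds the size of [A], so all later layers are empty. *)
Lemma sum_layers (V : nmodType) A (f : L -> V) :
  \sum_(x <- A) f (phi x) =
  \sum_(j < #|` A|) \sum_(a <- layer A j) f a.
Proof.
rewrite sum_fibers.
under [RHS]eq_bigr => j _ do rewrite big_fset /= big_mkcond /=.
rewrite exchange_big /=; apply: eq_bigr => a _.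
rewrite -big_mkcond /= sumr_const; congr (_ *+ _).
have le_a : (fiber_size A a <= #|` A|)%N by rewrite count_size.
rewrite -sum1_card (big_ord_narrow le_a) /=.
by rewrite sum1_card card_ord.
Qed.

Lemma sum_card_layer A : (\sum_(j < #|` A|) #|` layer A j| = #|` A|)%N.
Proof.
rewrite -[RHS]sum1_size [RHS](sum_layers A (fun=> 1%N)).
by apply: eq_bigr => j _; rewrite sum1_size.
Qed.

Lemma fiber_sizeE A a :
  fiber_size A a = #|` [fset x in A | phi x == a]|%fset.
Proof. by rewrite /fiber_size -sum1_count -[RHS]sum1_size big_fset. Qed.

Lemma leq_fiber_sizeB A B a :
  (fiber_size A a - fiber_size B a <= fiber_size (A `\` B)%fset a)%N.
Proof.
rewrite !fiber_sizeE.
have -> : [fset x in (A `\` B)%fset | phi x == a]%fset =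
    ([fset x in A | phi x == a] `\` [fset x in B | phi x == a])%fset.
  apply/fsetP => x; rewrite !inE.
  by case: (phi x == a); rewrite ?andbT ?andbF.
by rewrite cardfsD leq_sub2l // fsubset_leq_card // fsubsetIr.
Qed.

(** A point [a] lies in layer [j] of [A] but not of [B] exactly when
    [fiber_size B a <= j < fiber_size A a]. The number of such [j] is at most the number of points
    of [A] outside [B] that map to [a]. *)
Lemma leq_sum_card_layerB n A B :
  (\sum_(j < n) #|` (layer A j `\` layer B j)%fset| <=
   #|` (A `\` B)%fset|)%N.
Proof.
have cardE (j : 'I_n) : #|` (layer A j `\` layer B j)%fset| =
    (\sum_(a <- (phi @` A)%fset) (fiber_size B a <= j < fiber_size A a))%N.
  rewrite -sum1_size -big_mkcond /= [RHS]big_fset_condE; apply: eq_fbigl => a.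
  rewrite inE !in_layer -leqNgt !inE; case: (ltnP j) => [lt_j|].
    rewrite andbT (@fiber_size_gt0 A a) ?andbT //; exact: leq_ltn_trans lt_j.
  by rewrite !andbF.
under eq_bigr => j _ do rewrite cardE.
rewrite exchange_big /=.
have le_fiber a : (\sum_(j < n) (fiber_size B a <= j < fiber_size A a) <=
    \sum_(x <- (A `\` B)%fset) (phi x == a))%N.
  rewrite -[leqRHS]big_mkcond sum1_count.
  apply: leq_trans (leq_fiber_sizeB A B a).
  rewrite -[leqLHS]big_mkcond
    -(big_mkord (fun j => fiber_size B a <= j < _)%N (fun=> 1%N)).
  rewrite sum1_count -size_filter -[leqRHS](size_iota (fiber_size B a)).
  apply: uniq_leq_size => [|j]; first by rewrite filter_uniq // iota_uniq.
  rewrite mem_filter mem_iota => /andP[/andP[le_j lt_j] _].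
  by rewrite le_j subnKC // (leq_trans le_j) // ltnW.
apply: leq_trans; first by apply: leq_sum => a _; apply: le_fiber.
rewrite exchange_big -sum1_size; apply: leq_sum => x _ /=.
rewrite -big_mkcond sum1_count /=.
under eq_count => a do rewrite eq_sym.
by rewrite count_uniq_mem ?leq_b1.
Qed.

End Layers.

(** * Translates and boundaries of finite subsets of a group *)

Section Translates.
Variable G : groupType.
Implicit Types (A B F : {fset G}) (g t x : G).

Lemma card_fsymdiff (K : choiceType) (X Y : {fset K}) :
  #|` fsymdiff X Y| = (#|` (X `\` Y)%fset| + #|` (Y `\` X)%fset|)%N.
Proof.
rewrite /fsymdiff cardfsU -[RHS]subn0; congr (_ - _)%N.
apply/eqP; rewrite cardfs_eq0; apply/eqP/fsetP => x; rewrite !inE.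
by case: (x \in X); rewrite ?andbF.
Qed.

Lemma sum_fsetB (V : zmodType) (K : choiceType) (X Y : {fset K}) (f : K -> V) :
  \sum_(x <- X) f x - \sum_(x <- Y) f x =
  \sum_(x <- (X `\` Y)%fset) f x - \sum_(x <- (Y `\` X)%fset) f x.
Proof.
have sumE (A B : {fset K}) : \sum_(x <- A) f x =
    \sum_(x <- (A `&` B)%fset) f x + \sum_(x <- (A `\` B)%fset) f x.
  rewrite (big_fsetID _ (mem B)); congr (_ + _); apply: eq_fbigl => x;
    by rewrite !inE // andbC.
by rewrite (sumE X Y) (sumE Y X) fsetIC opprD addrACA subrr add0r.
Qed.

Definition right_translate g A : {fset G} := [fset (x * g)%g | x in A]%fset.

Lemma in_left_translate t A x :
  (x \in left_translate t A) = ((t^-1 * x)%g \in A).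
Proof.
apply/imfsetP/idP => [[y yA ->]|xA]; first by rewrite mulKg.
by exists (t^-1 * x)%g; rewrite ?mulVKg.
Qed.

Lemma in_right_translate g A x :
  (x \in right_translate g A) = ((x * g^-1)%g \in A).
Proof.
apply/imfsetP/idP => [[y yA ->]|xA]; first by rewrite mulgK.
by exists (x * g^-1)%g; rewrite ?mulgVK.
Qed.

Lemma sum_left_translate (V : nmodType) t A (f : G -> V) :
  \sum_(x <- left_translate t A) f x = \sum_(x <- A) f (t * x)%g.
Proof.
by rewrite eq_big_imfset /= ?big_map // => x y _ _; apply: mulgI.
Qed.

Lemma sum_right_translate (V : nmodType) g A (f : G -> V) :
  \sum_(x <- right_translate g A) f x = \sum_(x <- A) f (x * g)%g.
Proof.
by rewrite eq_big_imfset /= ?big_map // => x y _ _; apply: mulIg.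
Qed.

Lemma card_right_translate g A : #|` right_translate g A| = #|` A|.
Proof. by rewrite card_imfset //; apply: mulIg. Qed.

(** The numerator of the ratio in [left_folner]. *)
Definition boundary_size t A : nat := #|` fsymdiff A (left_translate t A)|.

Lemma boundary_size_right_translate t g A :
  boundary_size t (right_translate g A) = boundary_size t A.
Proof.
rewrite /boundary_size -[RHS](card_right_translate g); congr #|` _|.
apply/fsetP => x; rewrite in_right_translate /fsymdiff !(in_fsetU, in_fsetD).
by rewrite !in_left_translate !in_right_translate !mulgA.
Qed.

End Translates.

(** * Boundaries of the layers of a homomorphism *)

Section BoundaryOfLayers.
Variable G : groupType.
Implicit Types (A : {fset G}) (g t : G).

Lemma layer_left_translate (Q : groupType) (phi : G -> Q) t A j :
  {morph phi : x y / (x * y)%g} ->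
  layer phi (left_translate t A) j = left_translate (phi t) (layer phi A j).
Proof.
move=> phiM; apply/fsetP => a; rewrite in_left_translate !in_layer.
congr (_ < _)%N; rewrite /fiber_size -!sum1_count [LHS]big_mkcond.
rewrite sum_left_translate -big_mkcond; apply: eq_bigl => x /=.
by rewrite phiM (can2_eq (mulKg _) (mulVKg _)).
Qed.

(** Layers commute with translation, so each of the two one-sided differences making up a boundary
    is handled by [leq_sum_card_layerB]. *)
Lemma leq_sum_boundary_size_layer (Q : groupType) (phi : G -> Q) t A n :
  {morph phi : x y / (x * y)%g} ->
  (\sum_(j < n) boundary_size (phi t) (layer phi A j) <= boundary_size t A)%N.
Proof.
move=> phiM; rewrite /boundary_size [leqRHS]card_fsymdiff.
under eq_bigr => j _ do rewrite -layer_left_translate // card_fsymdiff.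
by rewrite big_split /= leq_add ?leq_sum_card_layerB.
Qed.

Lemma right_translate_folner (R : realType) g (F : nat -> {fset G}) :
  left_folner R F -> left_folner R (fun n => right_translate g (F n)).
Proof.
move=> [F0 Flim]; split=> [n|t].
  by rewrite -cardfs_gt0 card_right_translate cardfs_gt0.
apply: cvg_trans (Flim t); apply: near_eq_cvg; apply: nearW => n.
rewrite card_right_translate -!/(boundary_size _ _).
by rewrite boundary_size_right_translate.
Qed.

End BoundaryOfLayers.

(** * Averages of a unitary representation over finite sets *)

Section FolnerAverages.
Variables (R : realType) (G : groupType) (H : hilbertSpace R).
Variable (pi : unitaryRep G H).
Implicit Types (A : {fset G}) (g s t : G) (v w : H).

Lemma rep_inner s v w : inner H (pi s v) (pi s w) = inner H v w.
Proof. by have [+ _] := rep_unitary pi s; apply. Qed.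

Lemma hnorm_rep s v : hnorm (pi s v) = hnorm v.
Proof.
apply/eqP; rewrite -(@eqrXn2 _ 2) ?hnorm_ge0 //; apply/eqP/complexI.
by rewrite !hnorm_sqr rep_inner.
Qed.

Lemma rep_invK s v : pi s^-1%g (pi s v) = v.
Proof. by rewrite -repM mulVg rep1. Qed.

Lemma folner_average_linear A c v w :
  folner_average pi A (c *: v + w) =
  c *: folner_average pi A v + folner_average pi A w.
Proof.
rewrite /folner_average; under eq_bigr => s _ do rewrite linearP.
by rewrite big_split -scaler_sumr scalerDr !scalerA mulrC.
Qed.

Lemma folner_averageB A v w :
  folner_average pi A (v - w) = folner_average pi A v - folner_average pi A w.
Proof.
by rewrite addrC -scaleN1r folner_average_linear scaleN1r addrC.
Qed.

Lemma folner_averageZ A c v :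
  folner_average pi A (c *: v) = c *: folner_average pi A v.
Proof.
have := folner_averageB A v v; rewrite !subrr => avg0.
by rewrite -[c *: v]addr0 folner_average_linear avg0 addr0.
Qed.

Lemma card_folner_average A v :
  A != fset0 -> #|` A|%:R *: folner_average pi A v = \sum_(s <- A) pi s v.
Proof.
move=> A0; rewrite /folner_average scalerA mulfV ?scale1r //.
by rewrite pnatr_eq0 cardfs_eq0.
Qed.

Lemma hnorm_sum_rep A v : hnorm (\sum_(s <- A) pi s v) <= #|` A|%:R * hnorm v.
Proof.
apply: (le_trans (ler_hnorm_sum _ _ _)).
under eq_bigr => s _ do rewrite hnorm_rep.
by rewrite big_const_seq iter_addr_0 count_predT mulr_natl.
Qed.

Lemma ler_hnorm_folner_average A v : hnorm (folner_average pi A v) <= hnorm v.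
Proof.
rewrite /folner_average hnorm_natVZ.
have [->|A0] := eqVneq A fset0; first by rewrite cardfs0 invr0 mul0r hnorm_ge0.
by rewrite ler_pdivrMl ?hnorm_sum_rep // ltr0n cardfs_gt0.
Qed.

Lemma folner_average_right A g v :
  folner_average pi A (pi g v) = folner_average pi (right_translate g A) v.
Proof.
rewrite /folner_average card_right_translate sum_right_translate.
by congr (_ *: _); apply: eq_bigr => s _; rewrite repM.
Qed.

(** Applying [pi t] turns the sum over [A] into the sum over its translate; common terms cancel and
    each remaining one has norm [hnorm v]. *)
Lemma folner_average_left A t v :
  hnorm (pi t (folner_average pi A v) - folner_average pi A v) <=
  (boundary_size t A)%:R / #|` A|%:R * hnorm v.
Proof.
rewrite /folner_average linearZ linear_sum /= -scalerBr hnorm_natVZ.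
under eq_bigr => s _ do rewrite -repM.
rewrite -(sum_left_translate t A (fun s => pi s v)) sum_fsetB mulrAC mulrC.
rewrite ler_wpM2r ?invr_ge0 // (le_trans (ler_hnormD _ _)) // hnorm_opp.
rewrite /boundary_size card_fsymdiff natrD mulrDl addrC.
by apply: lerD; apply: hnorm_sum_rep.
Qed.

Lemma inner_folner_average A v w :
  A != fset0 -> invariant_vectors pi w ->
  inner H (folner_average pi A v) w = inner H v w.
Proof.
move=> A0 w_inv; rewrite /folner_average linearZl_LR linear_sumlz /=.
have innerE s : inner H (pi s v) w = inner H v w.
  by rewrite -{1}(w_inv s) rep_inner.
under eq_bigr => s _ do rewrite innerE.
rewrite big_const_seq count_predT iter_addr_0 -[X in _ * X]mulr_natl.
by rewrite mulrA mulVf ?mul1r // pnatr_eq0 cardfs_eq0.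
Qed.

(** Along a Folner sequence the averages are asymptotically fixed by each [pi t], and this passes to
    the limit. *)
Lemma folner_average_lim_invariant (F : nat -> {fset G}) v p :
  left_folner R F -> folner_average pi (F n) v @[n --> \oo] --> p ->
  invariant_vectors pi p.
Proof.
move=> [_ Flim] /cvg_hnormP vp t.
apply/eqP; rewrite -subr_eq0; apply/eqP/hnorm0_eq0/le_anti.
rewrite hnorm_ge0 andbT; apply/ler_addgt0Pl => e e0; rewrite addr0.
(* One third each for the distance from [p] to the average, for its image under [pi t], and for the
   displacement of the average by [pi t]. *)
have e3 : 0 < e / 3 by rewrite divr_gt0.
have bound : \forall n \near \oo,
    (boundary_size t (F n))%:R / #|` F n|%:R * hnorm v < e / 3.
  have lim0 : (boundary_size t (F n))%:R / #|` F n|%:R * hnorm v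
      @[n --> \oo] --> (0 : R).
    by rewrite -[X in _ --> X](mul0r (hnorm v)); apply: cvgMl; apply: Flim.
  move/cvgrPdist_lt : lim0 => /(_ _ e3); apply: filterS => n.
  by rewrite sub0r normrN; apply: le_lt_trans; apply: ler_norm.
near \oo => n.
have p_near : hnorm (p - folner_average pi (F n) v) < e / 3.
  by near: n; apply: vp.
have b_near : (boundary_size t (F n))%:R / #|` F n|%:R * hnorm v < e / 3.
  by near: n.
set a := folner_average pi (F n) v in p_near.
have tp : hnorm (pi t p - pi t a) < e / 3 by rewrite -linearB hnorm_rep.
have ta := le_lt_trans (folner_average_left (F n) t v) b_near.
have le1 := ler_hdistD (pi t a) (pi t p) p; have le2 := ler_hdistD a (pi t a) p.
rewrite -/a in ta; rewrite (hnorm_distC a) in le2.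
move: le1 le2 tp ta p_near.
move: (hnorm _) (hnorm _) (hnorm _) (hnorm _) (hnorm _).
by clear=> *; lra.
Unshelve. all: by end_near. Qed.

(* The limit determines the projection, so that no projection onto the
   invariant vectors has to be constructed. *)
Lemma folner_average_lim_orth_proj (F : nat -> {fset G}) v p :
  left_folner R F -> folner_average pi (F n) v @[n --> \oo] --> p ->
  orth_proj (invariant_vectors pi) v = p.
Proof.
move=> F_folner vp; have p_inv := folner_average_lim_invariant F_folner vp.
have inner0 w : invariant_vectors pi w -> inner H (v - p) w = 0.
  move=> w_inv; apply/eqP; rewrite -normr_eq0 -(RRe_real (normr_real _)).
  set c := complex.Re _.
  have lim0 : hnorm (folner_average pi (F n) v - p) * hnorm w @[n --> \oo] --> 
      (0 : R).
    rewrite -[X in _ --> X](mul0r (hnorm w)) -(hnorm0 H) -(subrr p).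
    by apply: cvgMl; apply: cvg_hnorm; apply: cvgB => //; apply: cvg_cst.
  have c0 : 0 <= c by rewrite -ler0c RRe_real.
  suff c_le0 : c <= 0 by rewrite (_ : c = 0) //; apply/le_anti; rewrite c_le0.
  (* Averaging [v] does not change its inner product with the invariant [w], so Cauchy-Schwarz puts
     the constant [c] below a sequence tending to 0. *)
  apply: (ler_cvg_to (cvg_cst c) lim0); apply: nearW => n.
  rewrite /c (_ : inner H (v - p) w =
    inner H (folner_average pi (F n) v - p) w).
    exact: inner_CauchySchwarz.
  by rewrite !innerBl inner_folner_average //; case: F_folner.
apply: xget_unique => [//|q [q_inv q0]].
apply/eqP; rewrite -subr_eq0; apply/eqP/(@inner_eq0 _ H).
have qpE : q - p = (v - p) - (v - q) by rewrite opprB [RHS]addrC addrA subrK.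
have qp_inv : invariant_vectors pi (q - p).
  by move=> s; rewrite linearB p_inv q_inv.
by rewrite {1}qpE innerBl inner0 // q0 // subrr.
Qed.

End FolnerAverages.

(** * Null vectors, their orthogonal complement and the kernel of the action on it *)

Section NullVectors.
Variables (R : realType) (G : groupType) (H : hilbertSpace R).
Variable (pi : unitaryRep G H).
Implicit Types (A : {fset G}) (F : nat -> {fset G}) (s t x : G) (u v w e : H).

(* Quantifying over all Folner sequences makes this set invariant: averaging
   [pi s v] over [F] amounts to averaging [v] over [F s]. *)
Definition null_vectors : set H :=
  [set v | forall F, left_folner R F ->
           folner_average pi (F n) v @[n --> \oo] --> (0 : H)].

Definition ergodic_complement : set H :=
  [set u | forall e, null_vectors e -> inner H u e = 0].

Lemma null_vectors0 : null_vectors 0.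
Proof.
move=> F _; apply/cvg_hnormP => e e0; apply: nearW => n.
rewrite sub0r hnorm_opp; apply: le_lt_trans e0.
by rewrite -(hnorm0 H) ler_hnorm_folner_average.
Qed.

Lemma null_vectors_linear c v w :
  null_vectors v -> null_vectors w -> null_vectors (c *: v + w).
Proof.
move=> v_null w_null F F_folner.
under eq_fun => n do rewrite folner_average_linear.
rewrite (_ : 0 = c *: 0 + 0 :> H); last by rewrite scaler0 addr0.
by apply: cvgD; [apply: cvgZ (v_null F F_folner); apply: cvg_cst|apply: w_null].
Qed.

Lemma null_vectorsB v w :
  null_vectors v -> null_vectors w -> null_vectors (v - w).
Proof.
by move=> v_null w_null; rewrite addrC -scaleN1r; apply: null_vectors_linear.
Qed.

Lemma null_vectors_rep s v : null_vectors v -> null_vectors (pi s v).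
Proof.
move=> v_null F F_folner; under eq_fun => n do rewrite folner_average_right.
exact: v_null (right_translate_folner s F_folner).
Qed.

(** Averaging over any finite set is a contraction, so approximating [v] by a null vector controls
    all its averages at once. *)
Lemma closed_null_vectors : closed null_vectors.
Proof.
move=> v v_adh F F_folner; apply/cvg_hnormP => e e0.
have e2 : 0 < e / 2 by rewrite divr_gt0.
have [w [w_null vw]] : exists w, null_vectors w /\ hnorm (v - w) < e / 2.
  have [|w [w_null vw]] := v_adh (ball v (e / 2)%:C%C).
    by apply: nbhsx_ballx; rewrite ltcR.
  by exists w; split=> //; rewrite -ltcR -hnormE; move: vw; rewrite -ball_normE.
have /cvg_hnormP/(_ _ e2) := w_null F F_folner.
apply: filterS => n; rewrite sub0r hnorm_opp => aw.
rewrite sub0r hnorm_opp -[v](subrK w) -[v - w]scale1r.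
rewrite folner_average_linear scale1r.
apply: (le_lt_trans (ler_hnormD _ _)).
have := ler_hnorm_folner_average pi (F n) (v - w).
move: aw vw; move: (hnorm _) (hnorm _) (hnorm _).
by clear=> *; lra.
Qed.

Lemma ergodic_complement_linear c u v :
  ergodic_complement u -> ergodic_complement v ->
  ergodic_complement (c *: u + v).
Proof.
move=> u_erg v_erg e e_null.
by rewrite innerPl u_erg // v_erg // mulr0 addr0.
Qed.

Lemma ergodic_complement0 : ergodic_complement 0.
Proof. by move=> e _; rewrite linear0l. Qed.

Lemma ergodic_complementB u v :
  ergodic_complement u -> ergodic_complement v -> ergodic_complement (u - v).
Proof.
move=> u_erg v_erg; rewrite addrC -scaleN1r.
exact: ergodic_complement_linear.
Qed.

Lemma ergodic_complement_rep s u :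
  ergodic_complement u -> ergodic_complement (pi s u).
Proof.
move=> u_erg e e_null; rewrite -(rep_inner pi s^-1%g) rep_invK.
exact/u_erg/null_vectors_rep.
Qed.

Lemma ergodic_complement_null u :
  ergodic_complement u -> null_vectors u -> u = 0.
Proof. by move=> u_erg u_null; apply/(@inner_eq0 _ H)/u_erg. Qed.

Lemma ergodic_decomposition v :
  exists u, ergodic_complement u /\ null_vectors (v - u).
Proof.
have [e [e_null ve]] := orth_decomposition v null_vectors0
  null_vectors_linear closed_null_vectors.
by exists (v - e); split; rewrite // opprB addrCA subrr addr0.
Qed.

Definition ergodic_kernel_set : set G :=
  [set t | forall u, ergodic_complement u -> pi t u = u].

Lemma ergodic_kernel1 : ergodic_kernel_set 1%g.
Proof. by move=> u _; rewrite rep1. Qed.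

Lemma ergodic_kernelF s t :
  ergodic_kernel_set s -> ergodic_kernel_set t -> ergodic_kernel_set (s / t)%g.
Proof.
move=> sK tK u u_erg; rewrite repM -{1}(tK u u_erg) rep_invK.
exact: sK.
Qed.

Lemma ergodic_kernelJ s t :
  ergodic_kernel_set s -> ergodic_kernel_set (s ^ t)%g.
Proof.
move=> sK u u_erg; rewrite conjgE !repM sK ?rep_invK //.
exact: ergodic_complement_rep.
Qed.

Definition ergodic_kernel : normalSubgroup G :=
  NormalSubgroup ergodic_kernel1 ergodic_kernelF ergodic_kernelJ.

End NullVectors.

(** Conjugation by [y] is injective, hence permutes a finite set that it maps into itself. *)
Lemma sum_conjg (K : groupType) (V : nmodType) (C : {fset K}) y (f : K -> V) :
  (forall a, a \in C -> (a ^ y)%g \in C) ->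
  \sum_(a <- C) f (a ^ y)%g = \sum_(a <- C) f a.
Proof.
move=> CJ; have CE : [fset (a ^ y)%g | a in C]%fset = C.
  apply/eqP; rewrite eqEfcard card_imfset ?leqnn ?andbT //=.
    by apply/fsubsetP => _ /imfsetP[a /= aC ->]; apply: CJ.
  exact: conjg_inj.
by rewrite -[in RHS]CE big_imfset //= => a b _ _; apply: conjg_inj.
Qed.

(** * Finite conjugacy classes in the quotient by the kernel *)

Section ErgodicQuotient.
Variables (R : realType) (G : groupType) (H : hilbertSpace R).
Variable (pi : unitaryRep G H).
Local Notation M := (ergodic_kernel pi).
Local Notation Q := (quotient_group M).
Local Notation proj := (quotient_proj M).
Implicit Types (a b : Q) (s t x : G) (u v w e : H).

Lemma proj_repr a : proj (repr a) = a.
Proof. by rewrite /quotient_proj reprK. Qed.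

(** On the ergodic complement the action factors through [Q], so the choice of representatives is
    immaterial there. *)
Lemma rep_proj s t u :
  ergodic_complement pi u -> proj s = proj t -> pi s u = pi t u.
Proof.
move=> u_erg /eqP/quotient_projP stK.
by rewrite -[t](mulVKg s) repM stK.
Qed.

Section FiniteClass.
Variables (C : {fset Q}).
Hypothesis CJ : forall y a, a \in C -> (a ^ y)%g \in C.

(** On the ergodic complement this is the action of the sum of [C] in the group ring of [Q], which
    is central because [C] is stable under conjugation. *)
Definition class_sum v : H := \sum_(a <- C) pi (repr a) v.

Lemma class_sum_rep s u : ergodic_complement pi u ->
  class_sum (pi s u) = pi s (class_sum u).
Proof.
move=> u_erg; rewrite /class_sum -(sum_conjg _ (CJ (proj s)^-1%g)).
rewrite linear_sum; apply: eq_bigr => a _; rewrite -!repM.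
apply: rep_proj => //; rewrite !quotient_projM !proj_repr.
by rewrite conjgE invgK -!mulgA mulVg mulg1.
Qed.

(** As [class_sum] commutes with [pi] on the complement, it can be applied after averaging; each
    resulting term [pi (repr a) w - w] tends to 0 by the Folner property. *)
Lemma class_sum_null u : ergodic_complement pi u ->
  null_vectors pi (class_sum u - #|` C|%:R *: u).
Proof.
move=> u_erg F F_folner; apply/cvg_hnormP => e e0.
have lim0 : \sum_(a <- C)
    (boundary_size (repr a) (F n))%:R / #|` F n|%:R * hnorm u
    @[n --> \oo] --> (0 : R).
  have lim_a a : (boundary_size (repr a) (F n))%:R / #|` F n|%:R * hnorm u
      @[n --> \oo] --> (0 : R).
    rewrite -[X in _ --> X](mul0r (hnorm u)).
    by apply: cvgMl; apply: F_folner.2.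
  elim: (enum_fset C) => [|a r IHr].
    by apply: cvg_near_cst; apply: nearW => n; rewrite big_nil.
  have := cvgD (lim_a a) IHr; rewrite addr0 => /(_ _); apply: cvg_trans.
  by apply: near_eq_cvg; apply: nearW => n; rewrite big_cons.
move/cvgrPdist_lt : lim0 => /(_ _ e0); apply: filterS => n.
rewrite sub0r normrN ger0_norm; last first.
  by apply: sumr_ge0 => a _; rewrite mulr_ge0 ?hnorm_ge0 ?divr_ge0.
apply: le_lt_trans; rewrite sub0r hnorm_opp.
set w := folner_average pi (F n) u.
suff -> : folner_average pi (F n) (class_sum u - #|` C|%:R *: u) =
    \sum_(a <- C) (pi (repr a) w - w).
  apply: (le_trans (ler_hnorm_sum _ _ _)); apply: ler_sum => a _.
  exact: folner_average_left.
rewrite sumrB big_const_seq count_predT iter_addr_0 -[w *+ _]scaler_nat.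
rewrite folner_averageB folner_averageZ; congr (_ - _).
rewrite /w /folner_average.
under eq_bigr => s _ do rewrite -class_sum_rep //.
rewrite exchange_big scaler_sumr; apply: eq_bigr => a _.
by rewrite [RHS]linearZ /=; congr (_ *: _); rewrite linear_sum.
Qed.

(** The difference of the two sides is a null vector and lies in the ergodic complement. *)
Lemma class_sum_eq u : ergodic_complement pi u ->
  class_sum u = #|` C|%:R *: u.
Proof.
move=> u_erg; apply/eqP; rewrite -subr_eq0; apply/eqP.
apply: ergodic_complement_null (class_sum_null u_erg).
apply: ergodic_complementB; rewrite ?scaler_nat.
  apply: (big_ind (ergodic_complement pi)) => [|v w v_erg w_erg|a _].
  - exact: ergodic_complement0.
  - by rewrite -[v]scale1r; apply: ergodic_complement_linear.
  - exact: ergodic_complement_rep.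
rewrite -[u *+ _]addr0 -scaler_nat.
by apply: ergodic_complement_linear => //; apply: ergodic_complement0.
Qed.

(* Strict convexity: a unit vector is the barycentre of unit vectors only if
   these are all equal to it. *)
Lemma finite_class_fixes a u : ergodic_complement pi u -> a \in C ->
  pi (repr a) u = u.
Proof.
move=> u_erg aC.
have dE : \sum_(b <- C) inner H (pi (repr b) u) u = inner H u u *+ #|` C|.
  rewrite -linear_sumlz -/(class_sum u) class_sum_eq //.
  by rewrite scaler_nat linearMnl.
(* When the squares are expanded, the cross terms add up by [dE] to exactly the total of the squared
   norms. *)
have sum0 : \sum_(b <- C) hnorm (pi (repr b) u - u) ^+ 2 = 0.
  apply: complexI; rewrite rmorph_sum /=.
  under eq_bigr => b _.
    rewrite hnorm_sqr (dnormB (inner H)) rep_inner; over.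
  rewrite sumrB !big_split /= -rmorph_sum dE /= rmorphMn /=.
  rewrite -[in X in _ - (_ + X)]hnorm_sqr conj_Creal ?complex_real // hnorm_sqr.
  by rewrite !big_const_seq !count_predT !iter_addr_0 subrr.
move/eqP: sum0; rewrite psumr_eq0 => [/allP/(_ a aC) /=|b _]; last first.
  by rewrite sqr_ge0.
by rewrite sqrf_eq0 => /eqP/hnorm0_eq0/eqP; rewrite subr_eq0 => /eqP.
Qed.

End FiniteClass.

(** A finite class acts trivially on the ergodic complement, so the representative of [a] lies in
    the kernel. *)
Lemma finite_class_trivial a :
  finite_set (conjugacy_class a) -> a = 1%g.
Proof.
move=> fin_a; pose C := fset_set (conjugacy_class a).
have CE b : (b \in C) = (b \in conjugacy_class a) by rewrite in_fset_set.
have CJ y b : b \in C -> (b ^ y)%g \in C.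
  rewrite !CE => /set_mem[x _ <-]; apply/mem_set.
  by exists (x * y)%g => //; rewrite conjgM.
have aC : a \in C.
  by rewrite CE; apply/mem_set; exists 1%g => //; rewrite conjg1.
rewrite -(proj_repr a); apply/eqP/quotient_projP.
rewrite mulg1 => u u_erg; rewrite -{1}(finite_class_fixes CJ u_erg aC).
exact: rep_invK.
Qed.

End ErgodicQuotient.

(** * Uniform ergodic bounds and their transport along a surjective homomorphism *)

Section UniformErgodicTheorem.
Variables (R : realType) (Q : groupType) (H : hilbertSpace R).
Variable (rho : unitaryRep Q H).
Hypothesis Q_countable : countable [set: Q].
Implicit Types (A : {fset Q}) (K : seq Q).

Lemma group_enumeration : exists g : nat -> Q, forall t, exists i, g i = t.
Proof.
have /countable_injP[f f_inj] := Q_countable.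
exists (fun i => xget 1%g [set t | f t = i]) => t; exists (f t).
by apply: xget_unique => // s /= /f_inj; apply; rewrite in_setT.
Qed.

(** Otherwise each [n] admits a bad set that is invariant up to [1 / (n + 1)] under the first [n]
    elements of [Q]; these sets form a Folner sequence whose averages stay at distance at least [e]
    from [p]. *)
Lemma uniform_ergodic_theorem v p :
  (forall F, left_folner R F ->
     folner_average rho (F n) v @[n --> \oo] --> p) ->
  forall e : R, 0 < e -> exists K (d : R), 0 < d /\
    forall A, A != fset0 ->
      (forall t, t \in K -> (boundary_size t A)%:R <= d * #|` A|%:R) ->
      hnorm (p - folner_average rho A v) < e.
Proof.
move=> vp e e0; apply: contrapT => no_bound.
have [g g_surj] := group_enumeration.
have bad n : exists A, [/\ A != fset0,
    forall i, (i < n)%N ->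
      (boundary_size (g i) A)%:R <= n.+1%:R^-1 * #|` A|%:R :> R &
    e <= hnorm (p - folner_average rho A v)].
  apply: contrapT => no_A; apply: no_bound.
  exists [seq g i | i <- iota 0 n], n.+1%:R^-1; split=> [|A A0 A_inv].
    by rewrite invr_gt0.
  rewrite ltNge; apply/negP => le_e; apply: no_A; exists A; split=> // i lt_i.
  by apply: A_inv; apply: map_f; rewrite mem_iota.
have [F FP] := choice bad.
have F_folner : left_folner R F.
  split=> [n|t]; first by case: (FP n).
  have [i <-] := g_surj t.
  apply/cvgrPdist_le => d d0.
  near=> n.
  have [F0 /(_ i) le_i _] := FP n.
  rewrite sub0r normrN ger0_norm ?divr_ge0 // ler_pdivrMr; last first.
    by rewrite ltr0n cardfs_gt0.
  (* From [n = i + 1] on, [g i] is among the first [n] elements. *)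
  apply: le_trans (le_i _) _; first by near: n; exists i.+1.
  rewrite ler_wpM2r // ltW //; near: n.
  exact: (near_infty_natSinv_lt (PosNum d0)).
have /cvg_hnormP/(_ _ e0)[N _ /(_ N (leqnn N))/=] := vp F F_folner.
by case: (FP N) => _ _ /le_lt_trans/[apply]; rewrite ltxx.
Unshelve. all: by end_near. Qed.

(** Sets that are not invariant enough are absorbed by the boundary term. The bound thus covers
    every [A] and can be summed over layers, some of which may be empty or far from invariant. *)
Lemma linear_ergodic_bound v p :
  (forall F, left_folner R F ->
     folner_average rho (F n) v @[n --> \oo] --> p) ->
  forall e : R, 0 < e -> exists K (c : R), 0 <= c /\
    forall A, hnorm (\sum_(a <- A) (rho a v - p)) <=
      e * #|` A|%:R + c * \sum_(t <- K) (boundary_size t A)%:R.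
Proof.
move=> /uniform_ergodic_theorem vp e e0; have [K [d [d0 Kd]]] := vp e e0.
have C0 : 0 <= hnorm v + hnorm p by rewrite addr_ge0 ?hnorm_ge0.
(* If some [t] in [K] has boundary above [d] times the size of [A], this constant times that
   boundary is at least the trivial bound, [hnorm v + hnorm p] for each element of [A]. *)
exists K, ((hnorm v + hnorm p) / d); split=> [|A].
  by rewrite divr_ge0 // ltW.
have [->|A0] := eqVneq A fset0.
  rewrite big_seq_fset0 hnorm0 addr_ge0 ?cardfs0 ?mulr0 // mulr_ge0 //.
    by rewrite divr_ge0 // ltW.
  by rewrite sumr_ge0.
have c0 : 0 <= (hnorm v + hnorm p) / d by rewrite divr_ge0 // ltW.
have [/allP K_inv|] :=
    boolP (all (fun t => (boundary_size t A)%:R <= d * #|` A|%:R) K).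
  have -> : \sum_(a <- A) (rho a v - p) =
      #|` A|%:R *: (folner_average rho A v - p).
    rewrite scalerBr card_folner_average // sumrB big_const_seq count_predT.
    by rewrite iter_addr_0 scaler_nat.
  rewrite hnorm_natZ mulrC hnorm_distC -[leLHS]addr0 lerD //.
    by rewrite ler_wpM2r // ltW // Kd.
  by rewrite mulr_ge0 // sumr_ge0.
move=> /allPn[t tK]; rewrite -ltNge => lt_t.
apply: (@le_trans _ _ ((hnorm v + hnorm p) * #|` A|%:R)).
  apply: (le_trans (ler_hnorm_sum _ _ _)).
  apply: (@le_trans _ _ (\sum_(a <- A) (hnorm v + hnorm p))).
    apply: ler_sum => a _.
    by rewrite -(hnorm_rep rho a v) -(hnorm_opp p) ler_hnormD.
  by rewrite big_const_seq count_predT iter_addr_0 mulr_natr.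
apply: ler_wpDl; first by rewrite mulr_ge0 // ltW.
rewrite -mulrA ler_wpM2l ?addr_ge0 ?hnorm_ge0 //.
rewrite ler_pdivlMl // (le_trans (ltW lt_t)) //.
by rewrite (big_rem t tK) /= lerDl sumr_ge0.
Qed.

(** The sum over [F n] splits into sums over layers, to which [linear_ergodic_bound] applies. The
    sizes of the layers add up to that of [F n], and their boundaries to at most those of [F n]
    along lifts of the elements of [K]. *)
Lemma transported_ergodic_theorem (G : groupType) (phi : G -> Q) (v p : H) :
  {morph phi : x y / (x * y)%g} ->
  set_surj [set: G] [set: Q] phi ->
  (forall F, left_folner R F ->
     folner_average rho (F n) v @[n --> \oo] --> p) ->
  forall F : nat -> {fset G}, left_folner R F ->
    (#|` F n|%:R^-1 *: \sum_(s <- F n) rho (phi s) v : H) @[n --> \oo] --> p.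
Proof.
move=> phiM phi_surj /linear_ergodic_bound vp F [F0 Flim].
apply/cvg_hnormP => e e0; have e2 : 0 < e / 2 by rewrite divr_gt0.
have [K [c [c0 Kc]]] := vp _ e2.
have phi_preim t : exists x, phi x = t.
  by have [x _ <-] := phi_surj t I; exists x.
(* [h] lifts elements of [Q] to [G], where the Folner property of [F] applies. *)
have [h hK] := choice phi_preim.
have lim0 : c * \sum_(t <- K) ((boundary_size (h t) (F n))%:R / #|` F n|%:R)
    @[n --> \oo] --> (0 : R).
  rewrite -[X in _ --> X](mulr0 c); apply: cvgMr.
  elim: K {Kc} => [|t K IHK].
    by apply: cvg_near_cst; apply: nearW => n; rewrite big_nil.
  have := cvgD (Flim (h t)) IHK; rewrite addr0 => /(_ _); apply: cvg_trans.
  by apply: near_eq_cvg; apply: nearW => n; rewrite big_cons.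
move/cvgrPdist_lt : lim0 => /(_ _ e2); apply: filterS => n.
rewrite sub0r normrN ger0_norm => [lt_c|]; last first.
  by rewrite mulr_ge0 // sumr_ge0 // => t _; rewrite divr_ge0.
have n0 : 0 < #|` F n|%:R :> R by rewrite ltr0n cardfs_gt0.
have n0C : #|` F n|%:R != 0 :> R[i] by rewrite pnatr_eq0 cardfs_eq0.
rewrite hnorm_distC.
have -> : #|` F n|%:R^-1 *: \sum_(s <- F n) rho (phi s) v - p =
    #|` F n|%:R^-1 *: \sum_(s <- F n) (rho (phi s) v - p).
  rewrite sumrB scalerBr; congr (_ - _).
  rewrite big_const_seq count_predT iter_addr_0 -[p *+ _]scaler_nat scalerA.
  by rewrite mulVf ?scale1r.
rewrite hnorm_natVZ ltr_pdivrMl // (sum_layers phi _ (fun a => rho a v - p)).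
apply: (le_lt_trans (ler_hnorm_sum _ _ _)).
apply: (le_lt_trans (ler_sum _ (fun j _ => Kc _))).
rewrite big_split /= -!mulr_sumr.
have -> : \sum_(j < #|` F n|) #|` layer phi (F n) j|%:R = #|` F n|%:R :> R.
  by rewrite -natr_sum sum_card_layer.
rewrite [e in ltRHS]splitr mulrDr [e / 2 * _]mulrC ltrD2l.
rewrite -ltr_pdivrMl // mulrCA; apply: le_lt_trans lt_c.
rewrite ler_wpM2l // exchange_big -mulr_suml mulrC ler_wpM2r ?invr_ge0 //.
apply: ler_sum => t _; rewrite -natr_sum ler_nat -{1}(hK t).
exact: leq_sum_boundary_size_layer.
Qed.

End UniformErgodicTheorem.

(** * Unitary representation of the quotient group *)

Section QuotientRepresentation.
Variables (R : realType) (G : groupType) (H : hilbertSpace R).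
Variable (pi : unitaryRep G H).
Local Notation M := (ergodic_kernel pi).
Local Notation Q := (quotient_group M).
Local Notation proj := (quotient_proj M).
Implicit Types (a b : Q) (s t x : G) (u v w e p : H).

Definition ergodic_part v : H :=
  projT1 (cid (ergodic_decomposition pi v)).

Lemma ergodic_part_complement v : ergodic_complement pi (ergodic_part v).
Proof. by rewrite /ergodic_part; case: cid => u []. Qed.

Lemma ergodic_part_null v : null_vectors pi (v - ergodic_part v).
Proof. by rewrite /ergodic_part; case: cid => u []. Qed.

(** Two candidates differ by a vector that is both null and orthogonal to the null vectors.
    Linearity of [ergodic_part] and its compatibility with [quotient_op] follow from this
    uniqueness. *)
Lemma ergodic_part_unique u v :
  ergodic_complement pi u -> null_vectors pi (v - u) -> ergodic_part v = u.
Proof.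
move=> u_erg vu; apply/eqP; rewrite -subr_eq0; apply/eqP.
apply: (ergodic_complement_null (pi := pi)).
  by apply: ergodic_complementB => //; apply: ergodic_part_complement.
rewrite (_ : _ - u = v - u - (v - ergodic_part v)); last first.
  by rewrite opprB [RHS]addrC addrA subrK.
exact: null_vectorsB vu (ergodic_part_null v).
Qed.

Lemma ergodic_part_linear : linear ergodic_part.
Proof.
move=> c v w; apply: ergodic_part_unique.
  by apply: ergodic_complement_linear; apply: ergodic_part_complement.
rewrite opprD addrACA -scalerBr.
by apply: null_vectors_linear; apply: ergodic_part_null.
Qed.

HB.instance Definition _ :=
  GRing.isLinear.Build R[i] H H *:%R ergodic_part ergodic_part_linear.

(* The quotient acts through [pi] on the ergodic complement and trivially on
   the null vectors, which avoids making the complement a Hilbert space. *)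
Definition quotient_op a v : H :=
  pi (repr a) (ergodic_part v) + (v - ergodic_part v).

Lemma quotient_op_linear a : linear (quotient_op a).
Proof.
move=> c v w; rewrite /quotient_op ergodic_part_linear linearP opprD.
rewrite scalerDr scalerBr.
by rewrite [RHS]addrACA; congr (_ + _); rewrite addrACA.
Qed.

HB.instance Definition _ a :=
  GRing.isLinear.Build R[i] H H *:%R (quotient_op a) (quotient_op_linear a).

Lemma ergodic_part_quotient_op a v :
  ergodic_part (quotient_op a v) = pi (repr a) (ergodic_part v).
Proof.
apply: ergodic_part_unique.
  by apply: ergodic_complement_rep; apply: ergodic_part_complement.
by rewrite /quotient_op [X in X - _]addrC addrK; apply: ergodic_part_null.
Qed.

Lemma quotient_opM a b v :
  quotient_op (a * b)%g v = quotient_op a (quotient_op b v).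
Proof.
rewrite {2}/quotient_op ergodic_part_quotient_op /quotient_op.
rewrite -repM [X in _ = _ + (X - _)]addrC addrK; congr (_ + _).
apply: rep_proj; first exact: ergodic_part_complement.
by rewrite quotient_projM !proj_repr.
Qed.

Lemma quotient_op1 v : quotient_op 1%g v = v.
Proof.
rewrite /quotient_op (rep_proj (t := 1%g)) ?rep1 ?proj_repr //.
  by rewrite addrC subrK.
exact: ergodic_part_complement.
Qed.

(** The mixed inner products vanish; hence [quotient_op] preserves inner products as soon as it does
    so on each summand. *)
Lemma inner_ergodic_sum u1 u2 e1 e2 :
  ergodic_complement pi u1 -> ergodic_complement pi u2 ->
  null_vectors pi e1 -> null_vectors pi e2 ->
  inner H (u1 + e1) (u2 + e2) = inner H u1 u2 + inner H e1 e2.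
Proof.
move=> u1_erg u2_erg e1_null e2_null.
have innerDl u v w : inner H (u + v) w = inner H u w + inner H v w.
  exact: linearDl.
have innerDr u v w : inner H u (v + w) = inner H u v + inner H u w.
  exact: linearDr.
rewrite innerDl !innerDr (u1_erg e2) // addr0.
have -> : inner H e1 u2 = 0 by apply: inner_eq0C; apply: u2_erg.
by rewrite add0r.
Qed.

Lemma quotient_op_unitary a : unitary (quotient_op a : {linear H -> H}).
Proof.
split=> [v w|v _] /=.
  have ep := ergodic_part_complement; have en := ergodic_part_null.
  rewrite /quotient_op inner_ergodic_sum //; try exact: ergodic_complement_rep.
  rewrite rep_inner -inner_ergodic_sum //.
  by rewrite [_ + (v - _)]addrC [_ + (w - _)]addrC !subrK.
exists (quotient_op a^-1%g v) => //.
by rewrite -quotient_opM mulgV quotient_op1.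
Qed.

Definition quotient_rep : unitaryRep Q H :=
  @UnitaryRep _ _ _ (fun a => quotient_op a : {linear H -> H})
    quotient_op_unitary quotient_op1 quotient_opM.

Lemma quotient_rep_proj s u :
  ergodic_complement pi u -> quotient_rep (proj s) u = pi s u.
Proof.
move=> u_erg; rewrite /= /quotient_op (@ergodic_part_unique u u) //.
  rewrite subrr addr0; apply: rep_proj => //; exact: proj_repr.
by rewrite subrr; apply: null_vectors0.
Qed.

Lemma folner_average_cvg_complement v p (F : nat -> {fset G}) :
  left_folner R F ->
  folner_average pi (F n) (ergodic_part v) @[n --> \oo] --> p ->
  folner_average pi (F n) v @[n --> \oo] --> p.
Proof.
move=> F_folner up; have := cvgD up (ergodic_part_null v F_folner).
rewrite addr0 => /(_ _); apply: cvg_trans.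
have avgE n : folner_average pi (F n) v =
    folner_average pi (F n) (ergodic_part v) +
    folner_average pi (F n) (v - ergodic_part v).
  by rewrite folner_averageB addrC subrK.
by apply: near_eq_cvg; apply: nearW => n; apply/esym/avgE.
Qed.

End QuotientRepresentation.

(** * Failure of the ergodic theorem and the ICC property for the quotient by the kernel *)

Theorem corollary1p3 (R : realType) (G : groupType)
    (G_countable : countable [set: G]) (G_amenable : amenable R G)
    (G_fails : ~ left_strong_ergodic_theorem R G) :
  exists N : normalSubgroup G,
    icc (quotient_group N) /\
    ~ left_strong_ergodic_theorem R (quotient_group N).
Proof.
have [H [pi [F [F_folner [v Fv]]]]] : exists (H : hilbertSpace R)
    (pi : unitaryRep G H) (F : nat -> {fset G}), left_folner R F /\
    exists v, ~ (folner_average pi (F n) v @[n --> \oo]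
      --> orth_proj (invariant_vectors pi) v).
  apply: contrapT => noH; apply: G_fails => H pi F F_folner v.
  by apply: contrapT => Fv; apply: noH; exists H, pi, F; split=> //; exists v.
(* A limit for the ergodic part would also be one for [v], hence would equal
   [orth_proj (invariant_vectors pi) v], contrary to [Fv]. *)
have no_lim (p : H) :
    ~ (folner_average pi (F n) (ergodic_part pi v) @[n --> \oo] --> p).
  move=> /(folner_average_cvg_complement F_folner) vp; apply: Fv.
  by rewrite (folner_average_lim_orth_proj F_folner vp).
have u_erg := @ergodic_part_complement _ _ _ pi v.
exists (ergodic_kernel pi); split; first split.
- exact: quotient_countable.
(* In a trivial quotient every [s] fixes the ergodic part, whose averages are then constant. *)
- apply: contrapT => trivQ; apply: (no_lim (ergodic_part pi v)).
  apply: cvg_near_cst; apply: nearW => n.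
  have [F0 _] := F_folner.
  have K1 s : quotient_proj (ergodic_kernel pi) s = 1%g.
    by apply: contrapT => s1; apply: trivQ; exists (quotient_proj _ s).
  rewrite /folner_average; under eq_bigr => s _.
    rewrite -quotient_rep_proj // K1 rep1; over.
  rewrite big_const_seq count_predT iter_addr_0.
  rewrite -[ergodic_part pi v *+ _]scaler_nat scalerA mulVf ?scale1r //.
  by rewrite pnatr_eq0 cardfs_eq0.
- move=> a a1 fin_a; apply: a1; exact: finite_class_trivial fin_a.
(* Applied to [quotient_rep pi] and transported to [G], the theorem for the quotient would make the
   averages of the ergodic part converge along [F], against [no_lim]. *)
move=> Q_ergodic.
have Q_countable := quotient_countable (ergodic_kernel pi) G_countable.
have lim_u := transported_ergodic_theorem Q_countable
  (@quotient_projM _ _) (@quotient_proj_surj _ _)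
  (fun E E_folner =>
     Q_ergodic H (quotient_rep pi) E E_folner (ergodic_part pi v))
  F_folner.
apply: (no_lim _ (cvg_trans _ lim_u)); apply: near_eq_cvg; apply: nearW => n.
rewrite /folner_average; congr (_ *: _); apply: eq_bigr => s _.
by rewrite quotient_rep_proj.
Qed.
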